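(* Let $N\ge2$ and consider $\mathbb{C}^{d_1}\otimes\cdots\otimes\mathbb{C}^{d_N}$ with bases $\{\mathbf{G}^{(l)}_i\}$ and constants $\kappa_l\ge1$ as in the context. Let $\{l_1,\dots,l_N\}=\{1,\dots,N\}$ with $l_1<\cdots<l_k$, $l_{k+1}<\cdots<l_N$, $l_1<l_{k+1}$, $k\in\{1,\dots,N-1\}$; put $R=(l_1,\dots,l_k)$, $C=(l_{k+1},\dots,l_N)$, and let $n\in\{1,\dots,k\}$, $m\in\{1,\dots,N-k\}$. For positive integers $p_1,p_2,q_1,q_2$ and real vectors $\bm u\in\mathbb{R}^{p_1}$, $\bm v\in\mathbb{R}^{p_2}$, $\bm\alpha\in\mathbb{R}^{q_1}$, $\bm\beta\in\mathbb{R}^{q_2}$, define for an $N$-party state $\rho$ the block matrix $$\mathcal{M}^{(l_1\cdots l_k|l_{k+1}\cdots l_N)}_{\bm u,\bm v,\bm\alpha,\bm\beta}(\rho)=\begin{pmatrix}\bm u\bm v^{\rm T} & \bm u\big(\bm\beta\otimes\mathrm{vec}_m(\mathcal{T}^{(l_{k+1}\cdots l_N)})\big)^{\rm T}\\ \big(\bm\alpha\otimes\mathrm{vec}_n(\mathcal{T}^{(l_1\cdots l_k)})\big)\bm v^{\rm T} & (\bm\alpha\bm\beta^{\rm T})\otimes\mathbf{T}^{(1\cdots N)}_{(R,n;C,m)}\end{pmatrix},$$ where $\otimes$ is the Kronecker product and $\mathbf{T}^{(1\cdots N)}_{(R,n;C,m)}$ is the mixed $(R,n;C,m)$-mode matrix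 unfolding of $\mathcal{T}^{(1\cdots N)}(\rho)$. If $\rho$ is biseparable under the bipartition $l_1\cdots l_k|l_{k+1}\cdots l_N$, then $$\big\|\mathcal{M}^{(l_1\cdots l_k|l_{k+1}\cdots l_N)}_{\bm u,\bm v,\bm\alpha,\bm\beta}(\rho)\big\|_{\rm tr}\le\sqrt{\|\bm u\|^2+\|\bm\alpha\|^2\mathfrak{m}^{(l_1\cdots l_k)}}\;\sqrt{\|\bm v\|^2+\|\bm\beta\|^2\mathfrak{m}^{(l_{k+1}\cdots l_N)}}.$$
   Context: For each $l$, $\{\mathbf{G}^{(l)}_i\}_{i=0}^{d_l^2-1}$ is a basis of complex $d_l\times d_l$ matrices with $\mathbf{G}^{(l)}_0=\mathbf{I}_{d_l}$, $\mathrm{Tr}(\mathbf{G}^{(l)}_i)=0$, $\mathrm{Tr}((\mathbf{G}^{(l)}_i)^\dagger\mathbf{G}^{(l)}_{i'})=\kappa_l\delta_{ii'}$ for $i,i'\ge1$, $\kappa_l\ge1$. For nonempty $S=\{s_1<\cdots<s_t\}\subseteq\{1,\dots,N\}$, $\mathcal{T}^{(S)}=\mathcal{T}^{(s_1\cdots s_t)}(\rho)\in\mathbb{C}^{(d_{s_1}^2-1)\times\cdots\times(d_{s_t}^2-1)}$ has entries $\prod_{s\in S}\frac{d_s}{\kappa_s}\,\mathrm{Tr}(\rho\,X_1\otimes\cdots\otimes X_N)$ with $X_s=\mathbf{G}^{(s)}_{i_s}$ ($i_s\in\{1,\dots,d_s^2-1\}$) for $s\in S$ and $X_s=\mathbf{I}_{d_s}$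 otherwise; its $j$-th mode is labelled $s_j$. Index map: $\iota_n^{(D_1,\dots,D_k)}(j_1,\dots,j_k)=(\prod_{s=1}^nD_s)\sum_{s'=n+1}^k((j_{s'}-1)\prod_{s''=s'+1}^kD_{s''})+\sum_{s'=1}^n((j_{s'}-1)\prod_{s''=s'+1}^nD_{s''})+1$ (empty products $1$, empty sums $0$). $\mathrm{vec}_n(\mathcal{A})$, for $\mathcal{A}=(a_{j_1\cdots j_k})\in\mathbb{C}^{D_1\times\cdots\times D_k}$, is the column vector with $a_{j_1\cdots j_k}$ in position $\iota_n(j_1,\dots,j_k)$. The mixed $(R,n;C,m)$-mode unfolding of a tensor with entries indexed by $(i_1,\dots,i_N)$, mode $l$ of size $D_l$, is the $(D_{l_1}\cdots D_{l_k})\times(D_{l_{k+1}}\cdots D_{l_N})$ matrix with that entry in row $\iota_n^{(D_{l_1},\dots,D_{l_k})}(i_{l_1},\dots,i_{l_k})$ and column $\iota_m^{(D_{l_{k+1}},\dots,D_{l_N})}(i_{l_{k+1}},\dots,i_{l_N})$. For $S=\{s_1<\cdots<s_t\}$ with $D=\prod_{s\in S}d_s$, $K=\prod_{s\in S}\kappa_s$, $d_S=\max_{s\in S}d_s$: $\mathfrak{m}^{(S)}=\frac{d_{s_1}^2-d_{s_1}}{\kappa_{s_1}}$ if $t=1$; $\mathfrak{m}^{(S)}=\frac{D}{K}\big(D+\frac{1}{t-1}-\frac{D}{t-1}\sum_{s\in S}\frac{1}{d_s^2}\big)$ if $t=2$, or $t\ge3$ and $D/d_S^2<1$; $\mathfrak{m}^{(S)}=\frac{D}{K}\big(D+\frac{2}{t-2}-\frac{D}{t-2}\sum_{s\in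 S}\frac{1}{d_s^2}\big)$ if $t\ge3$ and $D/d_S^2\ge1$. $\rho$ is biseparable under the bipartition $l_1\cdots l_k|l_{k+1}\cdots l_N$ if $\rho=\sum_ip_i\rho^{(l_1\cdots l_k)}_i\otimes\rho^{(l_{k+1}\cdots l_N)}_i$ with $p_i\ge0$, $\sum p_i=1$, and pure states $\rho^{(l_1\cdots l_k)}_i$, $\rho^{(l_{k+1}\cdots l_N)}_i$ on the respective groups of parties. $\|\cdot\|_{\rm tr}$ is the trace norm, $\|\cdot\|$ the Euclidean norm. *)

(* Defs.v *)
From HB Require Import structures.
From mathcomp Require Import all_boot all_order all_algebra.
From mathcomp Require Import complex mxtens.
From mathcomp Require Import reals.

Set Implicit Arguments.
Unset Strict Implicit.
Unset Printing Implicit Defensive.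

Import Order.TTheory GRing.Theory Num.Theory.
Local Open Scope ring_scope.

Definition Cof {R : realType} (x : R) : R[i] := (x%:C)%C.

Definition conjT {R : realType} {m n : nat} (A : 'M[R[i]]_(m, n)) : 'M[R[i]]_(n, m) :=
  (map_mx Num.conj A)^T.

Definition psd {R : realType} {n : nat} (S : 'M[R[i]]_n) : Prop :=
  forall x : 'cV[R[i]]_n, 0 <= (conjT x *m S *m x) 0 0.

(* ||A||_tr = Tr sqrt(A^dagger A) <= b, where sqrt is the PSD square root *)
Definition trnorm_le {R : realType} {r c : nat} (A : 'M[R[i]]_(r, c)) (b : R) : Prop :=
  forall S : 'M[R[i]]_c, psd S -> S *m S = conjT A *m A -> \tr S <= Cof b.

Definition sqnorm {R : realType} {p : nat} (u : 'cV[R]_p) : R := \sum_(i < p) u i 0 ^+ 2.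

Definition cmx {R : realType} {m n : nat} (A : 'M[R]_(m, n)) : 'M[R[i]]_(m, n) := map_mx Cof A.

(* Computational basis index of the full space C^{d_1} (x) ... (x) C^{d_N}
   (parties are 0, ..., N-1) *)
Definition Idx (N : nat) (d : 'I_N -> nat) := {dffun forall l : 'I_N, 'I_(d l)}.

Definition SubIdx (N : nat) (d : 'I_N -> nat) (S : {set 'I_N}) :=
  {dffun forall l : {x : 'I_N | x \in S}, 'I_(d (val l))}.

Definition restr (N : nat) (d : 'I_N -> nat) (S : {set 'I_N}) (a : Idx d) : SubIdx d S :=
  @finfun _ (fun l : {x : 'I_N | x \in S} => 'I_(d (val l))) (fun l => a (val l)).

(* index (i_1,...,i_N), i_l in {0,...,d_l^2-1}, of G^(1)_{i_1} (x) ... (x) G^(N)_{i_N} *)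
Definition Jdx (N : nat) (d : 'I_N -> nat) := {dffun forall l : 'I_N, 'I_(d l ^ 2)}.

Definition supp (N : nat) (d : 'I_N -> nat) (i : Jdx d) : {set 'I_N} :=
  [set l | (i l : nat) != 0%N].

(* prod_{s : i_s != 0} d_s/kappa_s * Tr(rho X_1 (x) ... (x) X_N), X_l = G^(l)_{i_l};
   this is the entry of T^(S)(rho) at (i_s)_{s in S} when supp i = S *)
Definition corr {R : realType} (N : nat) (d : 'I_N -> nat) (kappa : 'I_N -> R)
  (G : forall l : 'I_N, 'I_(d l ^ 2) -> 'M[R[i]]_(d l))
  (rho : Idx d -> Idx d -> R[i]) (i : Jdx d) : R[i] :=
  Cof (\prod_(l : 'I_N | (i l : nat) != 0%N) ((d l)%:R / kappa l)) *
  \sum_(a : Idx d) \sum_(b : Idx d) rho a b * \prod_(l : 'I_N) G l (i l) (b l) (a l).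

(* the index map iota_n^{(D_1,...,D_k)}(j_1,...,j_k), shifted to 0-based
   positions and 0-based indices j_s (k = size Ds) *)
Definition mix_index (n : nat) (Ds js : seq nat) : nat :=
  (\prod_(s < n) nth 0%N Ds s) *
    (\sum_(n <= s < size Ds) nth 0%N js s * \prod_(s.+1 <= t < size Ds) nth 0%N Ds t)
  + \sum_(s < n) nth 0%N js s * \prod_(s.+1 <= t < n) nth 0%N Ds t.

Definition dimL (N : nat) (d : 'I_N -> nat) (L : seq 'I_N) : nat :=
  \prod_(l <- L) (d l ^ 2 - 1).

Definition idxL (N : nat) (d : 'I_N -> nat) (n : nat) (L : seq 'I_N) (i : Jdx d) : nat :=
  mix_index n [seq (d l ^ 2 - 1)%N | l <- L] [seq (i l : nat).-1 | l <- L].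

Definition vecT {R : realType} (N : nat) (d : 'I_N -> nat) (kappa : 'I_N -> R)
  (G : forall l : 'I_N, 'I_(d l ^ 2) -> 'M[R[i]]_(d l))
  (rho : Idx d -> Idx d -> R[i]) (n : nat) (L : seq 'I_N) : 'cV[R[i]]_(dimL d L) :=
  \col_p \sum_(i : Jdx d | (supp i == [set l | l \in L]) && (idxL n L i == p))
     corr kappa G rho i.

Definition unfoldT {R : realType} (N : nat) (d : 'I_N -> nat) (kappa : 'I_N -> R)
  (G : forall l : 'I_N, 'I_(d l ^ 2) -> 'M[R[i]]_(d l))
  (rho : Idx d -> Idx d -> R[i]) (n m : nat) (LR LC : seq 'I_N)
  : 'M[R[i]]_(dimL d LR, dimL d LC) :=
  \matrix_(r, c) \sum_(i : Jdx d | [&& supp i == setT, idxL n LR i == r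
                                     & idxL m LC i == c]) corr kappa G rho i.

Definition parties (N : nat) (S : {set 'I_N}) : seq 'I_N := [seq l <- enum 'I_N | l \in S].

Definition Mmat {R : realType} (N : nat) (d : 'I_N -> nat) (kappa : 'I_N -> R)
  (G : forall l : 'I_N, 'I_(d l ^ 2) -> 'M[R[i]]_(d l))
  (rho : Idx d -> Idx d -> R[i]) (Rs : {set 'I_N}) (n m : nat)
  (p1 p2 q1 q2 : nat) (u : 'cV[R]_p1) (v : 'cV[R]_p2) (alpha : 'cV[R]_q1) (beta : 'cV[R]_q2)
  : 'M[R[i]]_(p1 + q1 * dimL d (parties Rs), p2 + q2 * dimL d (parties (~: Rs))) :=
  let LR := parties Rs in
  let LC := parties (~: Rs) in
  block_mx
    (cmx u *m (cmx v)^T)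
    (cmx u *m (tensmx (cmx beta) (vecT kappa G rho m LC))^T)
    (tensmx (cmx alpha) (vecT kappa G rho n LR) *m (cmx v)^T)
    (tensmx (cmx alpha *m (cmx beta)^T) (unfoldT kappa G rho n m LR LC)).

Definition mfrak {R : realType} (N : nat) (d : 'I_N -> nat) (kappa : 'I_N -> R)
  (S : seq 'I_N) : R :=
  let t := size S in
  let D : R := \prod_(l <- S) (d l)%:R in
  let K : R := \prod_(l <- S) kappa l in
  let dS : R := (\max_(l <- S) d l)%:R in
  let sinv : R := \sum_(l <- S) ((d l)%:R ^+ 2)^-1 in
  if t == 1%N then (D ^+ 2 - D) / K
  else if (t == 2%N) || (D / dS ^+ 2 < 1) then
    D / K * (D + 1 / (t%:R - 1) - D / (t%:R - 1) * sinv)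
  else D / K * (D + 2 / (t%:R - 2) - D / (t%:R - 2) * sinv).

Definition unitvec {R : realType} (T : finType) (psi : T -> R[i]) : Prop :=
  \sum_(a : T) psi a * Num.conj (psi a) = 1.

(* rho = sum_i p_i |psi_i><psi_i| (x) |phi_i><phi_i| with pure states psi_i on the
   parties in Rs and phi_i on the parties in ~: Rs *)
Definition biseparable {R : realType} (N : nat) (d : 'I_N -> nat) (Rs : {set 'I_N})
  (rho : Idx d -> Idx d -> R[i]) : Prop :=
  exists (K : nat) (p : 'I_K -> R) (psi : 'I_K -> SubIdx d Rs -> R[i])
         (phi : 'I_K -> SubIdx d (~: Rs) -> R[i]),
    [/\ forall j, 0 <= p j, \sum_j p j = 1, forall j, unitvec (psi j),
        forall j, unitvec (phi j) &
        forall a b : Idx d, rho a b =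
          \sum_j Cof (p j) * (psi j (restr Rs a) * phi j (restr (~: Rs) a))
                   * Num.conj (psi j (restr Rs b) * phi j (restr (~: Rs) b))].

(* Main.v *)
Require Import Defs.
From HB Require Import structures.
From mathcomp Require Import all_boot all_order all_algebra.
From mathcomp Require Import complex mxtens.
From mathcomp Require Import reals.
From mathcomp Require Import sesquilinear spectral ring zify.

Set Implicit Arguments.
Unset Strict Implicit.
Unset Printing Implicit Defensive.

Import Order.TTheory GRing.Theory Num.Theory.
Local Open Scope ring_scope.

(** For a biseparable state the block matrix is a convex combination of rank-one
    matrices [x_j y_j^T], with [x_j = (u, alpha (x) vec T(psi_j))] and
    [y_j = (v, beta (x) vec T(phi_j))], so its trace norm is at most the largest
    [|x_j| |y_j|]: if [S] is a positive square root of [A^* A], then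
    [tr S = tr (W^* A)] for a contraction [W] obtained by diagonalising [S], and
    Cauchy-Schwarz applies to each rank-one term.

    It remains to bound the full correlation tensor of a pure state on [t]
    parties.  Let [a_A >= 0] be the suitably normalised squared norm of the
    correlation tensor supported on [A].  Completeness of the local bases gives
    [sum_(A <= B) a_A = d_B Tr(rho_B^2)]; in particular [a_0 = 1] and
    [sum_A a_A = D].  For a pure state [Tr(rho_B^2) = Tr(rho_(~B)^2)], which for
    [B = {s}] reads [sum_(A, s \notin A) a_A = (D / d_s^2) (1 + a_{s})].  Summing over
    [s] weights [a_A] by [t - |A|] on the left; bounding these weights (and, when
    every [D / d_s^2 >= 1], moving the terms [a_{s}] to the left) bounds
    [sum_(A <> T) a_A] from below, hence [a_T] from above. *)

(** * Mixed-radix indices *)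

(** The leading digit is the one of index [m], with place value [P]. It contributes at most
    [(D m - 1) * P], and by induction the remaining digits stay below [P]. *)
Lemma radix_lt (D j : nat -> nat) (m n : nat) :
  (forall s, (m <= s < n)%N -> (j s < D s)%N) ->
  (\sum_(m <= s < n) j s * \prod_(s.+1 <= t < n) D t < \prod_(m <= t < n) D t)%N.
Proof.
have [k] := ubnP (n - m); elim: k m => // k IHk m le_nmk jD.
have [le_nm|lt_mn] := leqP n m; first by rewrite !big_geq.
rewrite big_ltn // [X in (_ < X)%N]big_ltn //.
set P := \prod_(m.+1 <= t < n) D t; set X := \sum_(m.+1 <= s < n) _.
have ltXP : (X < P)%N.
  apply: IHk => [|s /andP[lt_ms lt_sn]]; first by lia.
  by apply: jD; rewrite ltnW.
apply: (@leq_trans (j m * P + P)); first by rewrite ltn_add2l.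
by rewrite -mulSnr leq_mul2r jD ?leqnn ?orbT.
Qed.

(** Repeated Euclidean division: by [radix_lt] the tail is a remainder modulo the place value of the
    leading digit, so quotient and remainder are both determined. *)
Lemma radix_inj (D j j' : nat -> nat) (m n : nat) :
  (forall s, (m <= s < n)%N -> (j s < D s)%N) ->
  (forall s, (m <= s < n)%N -> (j' s < D s)%N) ->
  \sum_(m <= s < n) j s * \prod_(s.+1 <= t < n) D t =
    \sum_(m <= s < n) j' s * \prod_(s.+1 <= t < n) D t ->
  forall s, (m <= s < n)%N -> j s = j' s.
Proof.
have [k] := ubnP (n - m); elim: k m => // k IHk m le_nmk jD j'D.
have [le_nm _ s /andP[le_ms lt_sn]|lt_mn] := leqP n m.
  by move: (leq_trans lt_sn (leq_trans le_nm le_ms)); rewrite ltnn.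
have tl s : (m.+1 <= s < n)%N -> (m <= s < n)%N.
  by case/andP=> lt_ms ->; rewrite ltnW.
rewrite big_ltn // [RHS]big_ltn // => /eqP; rewrite eq_addl_mul.
- case/eqP=> jm eqS s /andP[]; rewrite leq_eqVlt => /predU1P[<- _ //|lt_ms lt_sn].
  apply: (IHk m.+1) eqS _ _; rewrite ?lt_ms //; last 2 first.
  + by move=> t /tl; exact: jD.
  + by move=> t /tl; exact: j'D.
  by lia.
- by apply: radix_lt => s /tl; exact: jD.
- by apply: radix_lt => s /tl; exact: j'D.
Qed.

(** The position is itself a two-digit number in base [D_1 ... D_n]: its remainder encodes the first
    [n] indices and its quotient the others, each in mixed radix. *)
Lemma mix_index_inj (n : nat) (Ds js js' : seq nat) :
  (n <= size Ds)%N -> size js = size Ds -> size js' = size Ds ->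
  (forall s, (s < size Ds)%N -> (nth 0%N js s < nth 0%N Ds s)%N) ->
  (forall s, (s < size Ds)%N -> (nth 0%N js' s < nth 0%N Ds s)%N) ->
  mix_index n Ds js = mix_index n Ds js' -> js = js'.
Proof.
move=> le_n sz sz' jD jD'; rewrite /mix_index.
rewrite -(big_mkord predT (fun s => nth 0%N Ds s)).
rewrite -(big_mkord predT (fun s => nth 0%N js s * \prod_(s.+1 <= t < n) nth 0%N Ds t)%N).
rewrite -(big_mkord predT (fun s => nth 0%N js' s * \prod_(s.+1 <= t < n) nth 0%N Ds t)%N).
have lo s : (0 <= s < n)%N -> (s < size Ds)%N.
  by move=> lt_sn; exact: leq_trans le_n.
rewrite ![(\prod_(0 <= _ < _) _ * _)%N]mulnC => /eqP; rewrite eq_addl_mul.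
- case/eqP=> eqhi eqlo; apply: (@eq_from_nth _ 0%N) => [|s]; first by rewrite sz.
  rewrite sz => lt_s; have [lt_sn|le_ns] := ltnP s n.
    apply: (radix_inj _ _ eqlo); rewrite ?lt_sn // => t /lo; [exact: jD|exact: jD'].
  apply: (radix_inj _ _ eqhi); rewrite ?le_ns // => t /andP[_]; [exact: jD|exact: jD'].
- by apply: radix_lt => s /lo; exact: jD.
- by apply: radix_lt => s /lo; exact: jD'.
Qed.

(** * Weights of the correlation tensors *)

Section Weights.
Variables (R : numFieldType) (T : finType) (d : T -> R) (a Q : {set T} -> R).
Hypothesis d_gt0 : forall l, 0 < d l.
Hypothesis a_ge0 : forall A, 0 <= a A.
Hypothesis aQ : forall B : {set T},
  \sum_(A : {set T} | A \subset B) a A = (\prod_(l in B) d l) * Q B.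
Hypothesis QC : forall B, Q B = Q (~: B).
Hypothesis Q0 : Q set0 = 1.

Let D := \prod_l d l.

Lemma weight_set0 : a set0 = 1.
Proof.
have := aQ set0; rewrite (big_pred1 set0) ?big_set0 ?mul1r ?Q0 //.
by move=> A /=; rewrite subset0.
Qed.

(** Globally pure states have global purity [Q setT = Q set0 = 1]. *)
Lemma sum_weight : \sum_A a A = D.
Proof.
have := aQ setT; rewrite QC setCT Q0 mulr1 => E.
transitivity (\sum_(A : {set T} | A \subset setT) a A).
  by apply: eq_bigl => A; rewrite subsetT.
by rewrite E; apply: eq_bigl => l; rewrite inE.
Qed.

(* Purity of a one-party marginal equals that of the complementary marginal. *)
Lemma sum_weight_notin (s : T) :
  \sum_(A : {set T} | s \notin A) a A = D * (d s ^+ 2)^-1 * (1 + a [set s]).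
Proof.
have E1 : 1 + a [set s] = d s * Q [set s].
  have := aQ [set s]; rewrite big_set1 => <-.
  rewrite (bigD1 set0) ?sub0set //= (bigD1 [set s]) /=; last first.
    by rewrite subxx -card_gt0 cards1.
  rewrite big1 ?addr0 ?weight_set0 // => A /andP[/andP[sA A0] As].
  by move: sA; rewrite subset1 (negPf As) (negPf A0).
have -> : \sum_(A : {set T} | s \notin A) a A =
    \sum_(A : {set T} | A \subset [set~ s]) a A.
  by apply: eq_bigl => A; rewrite -[A in RHS]setCK setCS sub1set inE.
rewrite aQ QC setCK E1.
(* One factor [1 / d s] comes from the missing party in the prefactor, the other from [Q [set s] =
   (1 + a [set s]) / d s]. *)
have -> : D = d s * \prod_(l in [set~ s]) d l.
  by rewrite /D (bigD1 s) //=; congr (_ * _); apply: eq_bigl => l; rewrite !inE.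
have := gt_eqF (d_gt0 s); move: (d s) => x /negbT x0; field.
by [].
Qed.

Let sinv := \sum_s (d s ^+ 2)^-1.

(** Double counting: [A] occurs in the sum attached to [s] once for each [s] outside [A]. *)
Lemma sum_card_weight :
  \sum_(A : {set T}) (#|~: A|)%:R * a A =
  D * sinv + \sum_s D * (d s ^+ 2)^-1 * a [set s].
Proof.
rewrite mulr_sumr -big_split /=.
transitivity (\sum_s \sum_(A : {set T} | s \notin A) a A).
  rewrite (exchange_big_dep predT) //=; apply: eq_bigr => A _.
  rewrite sumr_const mulr_natl; congr (_ *+ _).
  by apply: eq_card => s; rewrite !inE.
by apply: eq_bigr => s _; rewrite sum_weight_notin mulrDr mulr1.
Qed.

Lemma weightT_one : #|T| = 1%N -> a setT = D - 1.
Proof.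
move=> T1; rewrite -sum_weight (bigD1 setT) //= (bigD1 set0) /=; last first.
  by rewrite eq_sym -card_gt0 cardsT T1.
rewrite weight_set0 big1; first by rewrite addr0 addrK.
move=> A /andP[AT A0]; exfalso; move: (max_card A) AT A0.
rewrite T1 -card_gt0 => A1 AT A0; move/negP: AT; apply.
by rewrite eqEcard subsetT cardsT T1.
Qed.

(** Writes the target bound as a weighted sum over all [A], with weight [k] off [setT] and an extra
    [c] on [set0]. The two estimates below then reduce to comparing coefficients set by set. *)
Lemma sum_indicator_weight (c k : R) :
  \sum_A ((A == set0)%:R * c + k * (1 - (A == setT)%:R)) * a A =
  c + k * (D - a setT).
Proof.
under eq_bigr do rewrite mulrDl; rewrite big_split /=; congr (_ + _).
  rewrite (bigD1 set0) //= eqxx mul1r weight_set0 mulr1 big1 ?addr0 //.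
  by move=> A /negPf ->; rewrite !mul0r.
rewrite (eq_bigr (fun A => k * (a A - (A == setT)%:R * a A))); last first.
  by move=> A _; rewrite -mulrA mulrBl mul1r.
rewrite -mulr_sumr sumrB sum_weight; congr (_ * (_ - _)).
rewrite (bigD1 setT) //= eqxx mul1r big1 ?addr0 // => A /negPf ->.
by rewrite mul0r.
Qed.

(** The nonnegative one-party terms of [sum_card_weight] are dropped. The coefficient of [a A] is
    [t = 1 + (t - 1)] at [set0], [0] at [setT], and at most [t - 1] elsewhere; solving for [a setT]
    gives the bound. *)
Lemma weightT_le : (2 <= #|T|)%N ->
  a setT <= D + 1 / (#|T|%:R - 1) - D / (#|T|%:R - 1) * sinv.
Proof.
move=> T2; set t := #|T|%:R : R.
have t1 : 0 < t - 1 by rewrite subr_gt0 ltr1n.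
have sub : D * sinv <= 1 + (t - 1) * (D - a setT).
  have le1 : D * sinv <= \sum_(A : {set T}) (#|~: A|)%:R * a A.
    rewrite sum_card_weight lerDl sumr_ge0 // => s _.
    rewrite mulr_ge0 ?a_ge0 // mulr_ge0 ?invr_ge0 ?exprn_ge0 ?ltW //.
    exact: prodr_gt0.
  apply: (le_trans le1).
  rewrite -sum_indicator_weight.
  apply: ler_sum => A _; apply: ler_wpM2r; first exact: a_ge0.
  have [->|A0] := eqVneq A set0.
    rewrite setC0 cardsT -/t eq_sym -cards_eq0 cardsT.
    by case: (#|T|) T2 => [|?] //= _; rewrite subr0 !mulr1 ?mul1r addrC subrK.
  have [->|AT] := eqVneq A setT; first by rewrite setCT cards0 subrr mulr0 addr0 mul0r.
  rewrite subr0 !mulr1 ?mul0r add0r lerBrDr natr1 ler_nat.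
  by have := cardsC A; rewrite -card_gt0 in A0; lia.
have -> : D + 1 / (t - 1) - D / (t - 1) * sinv = D - (D * sinv - 1) / (t - 1).
  by field; rewrite gt_eqF.
rewrite lerBrDr -lerBrDl ler_pdivrMr //; move: sub; rewrite lerBlDl [(D - _) * _]mulrC.
by [].
Qed.

(** Each one-party term is now at least [a [set s]]. Moving these to the other side lowers the
    coefficient of singletons from [t - 1] to [t - 2], which already bounds it for larger sets; at
    [set0] it is [t = 2 + (t - 2)]. *)
Lemma weightT_le_large : (3 <= #|T|)%N -> (forall s, 1 <= D * (d s ^+ 2)^-1) ->
  a setT <= D + 2 / (#|T|%:R - 2) - D / (#|T|%:R - 2) * sinv.
Proof.
move=> T3 Ds; set t := #|T|%:R : R.
have t2 : 0 < t - 2 by rewrite subr_gt0 ltr_nat.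
have sub : D * sinv <= 2 + (t - 2) * (D - a setT).
  have le1 : D * sinv + \sum_s a [set s] <= \sum_(A : {set T}) (#|~: A|)%:R * a A.
    rewrite sum_card_weight lerD2l; apply: ler_sum => s _.
    by rewrite -[leLHS]mul1r ler_wpM2r ?a_ge0.
  rewrite -lerBrDr in le1; apply: (le_trans le1).
  have -> : \sum_s a [set s] = \sum_(A : {set T}) (#|A| == 1%N)%:R * a A.
    rewrite [RHS](eq_bigr (fun A : {set T} => \sum_(s | A == [set s]) a A)); last first.
      move=> A _; rewrite sumr_const mulr_natl; congr (_ *+ _).
      apply/eqP; have [/cards1P[s ->]|A1] := boolP (#|A| == 1%N).
        rewrite eq_sym; apply/eqP/(@eq_card1 _ s) => x.
        by rewrite inE -[RHS]eq_sym -(inj_eq set1_inj).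
      rewrite eq_sym; apply/eqP/eq_card0 => s; apply: negbTE.
      by apply: contra A1 => /(@eqP _ A [set s]) ->; rewrite cards1.
    rewrite (exchange_big_dep predT) //=; apply: eq_bigr => s _.
    by rewrite big_pred1_eq.
  rewrite -sumrB.
  rewrite -sum_indicator_weight.
  apply: ler_sum => A _; rewrite -mulrBl; apply: ler_wpM2r; first exact: a_ge0.
  have [->|A0] := eqVneq A set0.
    rewrite setC0 cardsT cards0 -/t subr0 eq_sym -cards_eq0 cardsT.
    by case: (#|T|) T3 => [|?] //= _; rewrite subr0 !mulr1 ?mul1r addrC subrK.
  have [->|AT] := eqVneq A setT.
    rewrite setCT cards0 subrr mulr0 addr0 mul0r cardsT.
    by case: (#|T|) T3 => [|[|?]] //= _; rewrite subr0.
  rewrite subr0 !mulr1 ?mul0r add0r lerBrDr addrAC lerBlDr -!natrD ler_nat.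
  have := cardsC A; move: A0; rewrite -card_gt0; case: eqP => /=; lia.
have -> : D + 2 / (t - 2) - D / (t - 2) * sinv = D - (D * sinv - 2) / (t - 2).
  by field; rewrite gt_eqF.
rewrite lerBrDr -lerBrDl ler_pdivrMr //; move: sub; rewrite lerBlDl [(D - _) * _]mulrC.
by [].
Qed.

End Weights.

(** * Trace norm of a sum of rank-one matrices *)

Section Adjoint.
Variable C : numClosedFieldType.

(** Over [R[i]] this unfolds to the same term as [conjT], so hypotheses stated with [conjT] apply
    directly. *)
Definition adjmx m n (A : 'M[C]_(m, n)) : 'M[C]_(n, m) := (map_mx Num.conj A)^T.

Lemma adjmxM m n p (A : 'M[C]_(m, n)) (B : 'M[C]_(n, p)) :
  adjmx (A *m B) = adjmx B *m adjmx A.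
Proof. by rewrite /adjmx map_mxM trmx_mul. Qed.

Lemma adjmxK m n (A : 'M[C]_(m, n)) : adjmx (adjmx A) = A.
Proof. by apply/matrixP => i j; rewrite !mxE conjCK. Qed.

Lemma adjmx_diag n (e : 'rV[C]_n) : adjmx (diag_mx e) = diag_mx (map_mx Num.conj e).
Proof. by rewrite /adjmx map_diag_mx tr_diag_mx. Qed.

Definition nrm2 n (x : 'cV[C]_n) : C := \sum_i `|x i 0| ^+ 2.

Lemma nrm2_ge0 n (x : 'cV[C]_n) : 0 <= nrm2 x.
Proof. by apply: sumr_ge0 => i _; rewrite exprn_ge0. Qed.

Lemma nrm2E n (x : 'cV[C]_n) : nrm2 x = (adjmx x *m x) 0 0.
Proof. by rewrite mxE; apply: eq_bigr => i _; rewrite normCK mulrC !mxE. Qed.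

Lemma nrm2_conj n (x : 'cV[C]_n) : nrm2 (map_mx Num.conj x) = nrm2 x.
Proof. by apply: eq_bigr => i _; rewrite mxE norm_conjC. Qed.

Lemma nrm2_col_mx m n (x : 'cV[C]_m) (y : 'cV[C]_n) :
  nrm2 (col_mx x y) = nrm2 x + nrm2 y.
Proof.
rewrite /nrm2 big_split_ord /=; congr (_ + _); apply: eq_bigr => i _.
  by rewrite col_mxEu.
by rewrite col_mxEd.
Qed.

Lemma nrm2_tens m n (x : 'cV[C]_m) (y : 'cV[C]_n) :
  nrm2 (tensmx x y : 'cV[C]_(m * n)) = nrm2 x * nrm2 y.
Proof.
rewrite /nrm2 mulr_sum; apply: eq_bigr => i _.
by rewrite !mxE normrM exprMn !ord1.
Qed.

Lemma cauchy_schwarz n (x y : 'cV[C]_n) :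
  `|(adjmx x *m y) 0 0| ^+ 2 <= nrm2 x * nrm2 y.
Proof.
have dotE (u v : 'cV[C]_n) : dotmx u^T v^T = (adjmx v *m u) 0 0.
  by rewrite dotmxE !mxE; apply: eq_bigr => i _; rewrite !mxE mulrC.
have [] := CauchySchwarz (@dotmx _ n) y^T x^T.
by rewrite /= !dotE -!nrm2E mulrC.
Qed.

(** Polarisation: basis vectors kill the diagonal, and the vectors [e_i + c e_j] with [c = 1] and
    [c = 'i] give [H i j + H j i = 0] and [H i j - H j i = 0]. *)
Lemma form_eq0 n (H : 'M[C]_n) :
  (forall x : 'cV[C]_n, (adjmx x *m H *m x) 0 0 = 0) -> H = 0.
Proof.
move=> form0.
have bil (i j : 'I_n) (c : C) :
    (adjmx (delta_mx i 0 + c *: delta_mx j 0 : 'cV[C]_n) *m H *m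
       (delta_mx i 0 + c *: delta_mx j 0 : 'cV[C]_n)) 0 0 =
    H i i + c * H i j + Num.conj c * H j i + `|c| ^+ 2 * H j j.
  have dE (k l : 'I_n) :
      ((delta_mx k 0 : 'cV[C]_n)^T *m H *m (delta_mx l 0 : 'cV[C]_n)) 0 0 = H k l.
    by rewrite trmx_delta -rowE -colE !mxE.
  have -> : adjmx (delta_mx i 0 + c *: delta_mx j 0 : 'cV[C]_n) =
      (delta_mx i 0)^T + Num.conj c *: (delta_mx j 0)^T.
    by apply/matrixP => k l; rewrite !mxE rmorphD rmorphM !rmorph_nat.
  rewrite !mulmxDl !mulmxDr -!scalemxAl -!scalemxAr.
  rewrite ![fun_of_matrix (_ + _) _ _]mxE ![fun_of_matrix (_ *: _) _ _]mxE.
  rewrite !dE normCK.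
  ring.
have Hii i : H i i = 0.
  have := bil i i 0; rewrite form0 normr0 expr0n /= rmorph0 !mul0r !addr0.
  by move=> <-.
apply/matrixP => i j; rewrite [RHS]mxE.
have := bil i j 1; rewrite form0 !Hii mulr0 addr0 add0r rmorph1 !mul1r => /esym/eqP.
rewrite addr_eq0 => /eqP Hij.
have := bil i j 'i; rewrite form0 !Hii mulr0 addr0 add0r conjCi Hij.
rewrite mulrN mulNr -opprD => /esym/eqP; rewrite oppr_eq0 -mulr2n mulrn_eq0 /=.
by rewrite mulf_eq0 (negPf (neq0Ci C)) /= => /eqP ->; rewrite oppr0.
Qed.

(** The form of [adjmx S - S] is a number's conjugate minus the number itself, and the values of the
    form of [S] are real. *)
Lemma psd_adjmx n (S : 'M[C]_n) :
  (forall x : 'cV[C]_n, 0 <= (adjmx x *m S *m x) 0 0) -> adjmx S = S.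
Proof.
move=> S_psd; apply/eqP; rewrite -subr_eq0; apply/eqP/form_eq0 => x.
rewrite mulmxBr mulmxBl mxE [X in _ + X]mxE.
have -> : adjmx x *m adjmx S *m x = adjmx (adjmx x *m S *m x).
  by rewrite !adjmxM adjmxK mulmxA.
rewrite [X in X - _]mxE mxE; have /ger0_real/CrealP -> := S_psd x.
by rewrite subrr.
Qed.

(** Polar decomposition with [W = A S^+], where [S^+] is the pseudo-inverse of [S]: the trace of
    [W^* A = S^+ S^2] is that of [S], and [W^* W = S^+ S^2 S^+] is the projection onto the range of
    [S]. *)
Lemma psd_root_polar r c (A : 'M[C]_(r, c)) (S : 'M[C]_c) :
  (forall x : 'cV[C]_c, 0 <= (adjmx x *m S *m x) 0 0) -> S *m S = adjmx A *m A ->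
  exists2 W : 'M[C]_(r, c), \tr S = \tr (adjmx W *m A) &
    forall w, nrm2 (W *m w) <= nrm2 w.
Proof.
move=> S_psd SS; have Sh := psd_adjmx S_psd.
have Sn : S \is normalmx.
  by apply/normalmxP; rewrite -map_trmx -/(adjmx S) Sh.
have /orthomx_spectralP := Sn.
have := spectral_unitarymx S; move: (spectralmx S) (spectral_diag S) => P la Pu.
have PcT : adjmx P = invmx P by rewrite invmx_unitary // -map_trmx.
have Punit := unitarymx_unit Pu.
rewrite -PcT => Sd.
have PP : P *m adjmx P = 1%:M by rewrite PcT mulmxV.
have PP' : adjmx P *m P = 1%:M by rewrite PcT mulVmx.
have laD : diag_mx la = P *m S *m adjmx P.
  by rewrite Sd !mulmxA PP mul1mx -mulmxA PP mulmx1.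
have la_real k : Num.conj (la 0 k) = la 0 k.
  have /matrixP/(_ k k) := congr1 (@adjmx _ _) laD.
  rewrite !adjmxM adjmxK Sh mulmxA -laD adjmx_diag !mxE eqxx !mulr1n.
  by [].
(* Since the inverse of [0] is [0], [g] is the spectrum of the pseudo-inverse of [S]. *)
pose g := map_mx (@GRing.inv C) la.
have gla k : g 0 k * la 0 k * la 0 k = la 0 k.
  rewrite mxE; have [->|k0] := eqVneq (la 0 k) 0; first by rewrite mulr0.
  by rewrite mulVf // mul1r.
have g_real : map_mx Num.conj g = g.
  by apply/matrixP => a k; rewrite !mxE ord1 fmorphV /= la_real.
have laS : diag_mx la *m diag_mx la = P *m (adjmx A *m A) *m adjmx P.
  rewrite -SS [X in X *m _]laD laD !mulmxA; congr (_ *m _ *m _).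
  by rewrite -[_ *m adjmx P *m P]mulmxA PP' mulmx1.
exists (A *m adjmx P *m diag_mx g *m P) => [|w].
  rewrite !adjmxM adjmxK adjmx_diag g_real -!mulmxA.
  rewrite mxtrace_mulC -!mulmxA.
  have -> : P *m (adjmx A *m (A *m adjmx P)) = diag_mx la *m diag_mx la.
    by rewrite laS !mulmxA.
  have -> : \tr S = \tr (diag_mx la).
    by rewrite [in LHS]Sd -mulmxA mxtrace_mulC -mulmxA PP mulmx1.
  rewrite !mulmx_diag !mxtrace_diag; apply: eq_bigr => k _.
  by rewrite !mxE -[in LHS]gla mulrA mxE.
have -> : nrm2 w = nrm2 (P *m w).
  by rewrite !nrm2E adjmxM -mulmxA [adjmx P *m _]mulmxA PP' mul1mx.
rewrite -[_ *m P *m w]mulmxA; move: (P *m w) => v.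
rewrite nrm2E !adjmxM adjmxK adjmx_diag g_real -!mulmxA.
rewrite [P *m _]mulmxA [P *m adjmx A *m _]mulmxA [_ *m (adjmx P *m _)]mulmxA.
rewrite -[P *m adjmx A *m A]mulmxA -laS !mulmxA.
rewrite -[adjmx v *m diag_mx g *m diag_mx la]mulmxA mulmx_diag.
rewrite -!mulmxA [diag_mx la *m _]mulmxA mulmx_diag.
rewrite [diag_mx _ *m (diag_mx _ *m v)]mulmxA mulmx_diag.
(* In the eigenbasis the coordinates with zero eigenvalue are erased and the others are kept. *)
rewrite mul_diag_mx mxE; apply: ler_sum => k _.
rewrite !mxE; have [->|k0] := eqVneq (la 0 k) 0.
  by rewrite mulr0 !mul0r mulr0 exprn_ge0.
by rewrite mulVf // mulfV // !mul1r mulrC -normCK.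
Qed.

Lemma trace_root_sum_le r c K (p : 'I_K -> C) (x : 'I_K -> 'cV[C]_r)
    (y : 'I_K -> 'cV[C]_c) (X Y : C) (S : 'M[C]_c) (A : 'M[C]_(r, c)) :
  A = \sum_j p j *: (x j *m (y j)^T) ->
  (forall j, 0 <= p j) -> \sum_j p j = 1 -> 0 <= X -> 0 <= Y ->
  (forall j, nrm2 (x j) <= X ^+ 2) -> (forall j, nrm2 (y j) <= Y ^+ 2) ->
  (forall x : 'cV[C]_c, 0 <= (adjmx x *m S *m x) 0 0) ->
  S *m S = adjmx A *m A -> \tr S <= X * Y.
Proof.
move=> AE p0 p1 X0 Y0 xX yY S_psd /(psd_root_polar S_psd)[W trS Wle].
(* Nonnegativity lets [\tr S] be replaced by its modulus, to which the triangle inequality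
   applies. *)
have trS_ge0 : 0 <= \tr S.
  apply: sumr_ge0 => k _; have := S_psd (delta_mx k 0).
  have -> : adjmx (delta_mx k 0 : 'cV[C]_c) = delta_mx 0 k.
    by apply/matrixP => i j; rewrite !mxE rmorph_nat andbC.
  by rewrite -rowE -colE !mxE.
have term j : `|\tr (adjmx W *m (x j *m (y j)^T))| <= X * Y.
  rewrite -(@ler_pXn2r _ 2) ?nnegrE ?normr_ge0 ?mulr_ge0 //.
  rewrite mulmxA mxtrace_mulC trace_mx11.
  (* The trace becomes the inner product of [W] applied to the conjugate of [y j] with [x j], ready
     for Cauchy-Schwarz and the contraction property. *)
  have -> : (y j)^T *m (adjmx W *m x j) = adjmx (W *m map_mx Num.conj (y j)) *m x j.
    rewrite adjmxM mulmxA; congr (_ *m _ *m _).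
    by apply/matrixP => a b; rewrite !mxE conjCK.
  apply: le_trans (cauchy_schwarz _ _) _; rewrite exprMn mulrC.
  apply: ler_pM; rewrite ?nrm2_ge0 //.
  by apply: le_trans (Wle _) _; rewrite nrm2_conj.
rewrite -[\tr S]ger0_norm // trS AE mulmx_sumr raddf_sum /=.
apply: le_trans (ler_norm_sum _ _ _) _.
apply: (@le_trans _ _ (\sum_j p j * (X * Y))).
  apply: ler_sum => j _; rewrite -scalemxAr linearZ /= normrM ger0_norm //.
  exact: ler_wpM2l.
by rewrite -mulr_suml p1 mul1r.
Qed.

End Adjoint.

(** * Local bases and correlations of a pure state *)

Section BasisCompleteness.
Variables (C : numClosedFieldType) (d : nat) (kappa : C).
Variable G : 'I_(d ^ 2) -> 'M[C]_d.
Hypothesis kappa_gt0 : 0 < kappa.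
Hypothesis G0 : forall j : 'I_(d ^ 2), (j : nat) = 0%N -> G j = 1%:M.
Hypothesis Gtr : forall j : 'I_(d ^ 2), (j : nat) != 0%N -> \tr (G j) = 0.
Hypothesis Gorth : forall j j' : 'I_(d ^ 2), (j : nat) != 0%N -> (j' : nat) != 0%N ->
  \tr (adjmx (G j) *m G j') = kappa * (j == j')%:R.

(** The inverse squared Hilbert-Schmidt norm of [G j], which is [d] for the identity and [kappa]
    otherwise. *)
Definition bweight (d : nat) (kappa : C) (j : 'I_(d ^ 2)) : C :=
  if (j : nat) == 0%N then d%:R^-1 else kappa^-1.

Lemma basis_gram (j j' : 'I_(d ^ 2)) :
  bweight kappa j * \tr (adjmx (G j) *m G j') = (j == j')%:R.
Proof.
have d0 : d%:R != 0 :> C.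
  by rewrite pnatr_eq0; case: (d) j => [[]|].
have conj_tr (A : 'M[C]_d) : \tr (adjmx A) = Num.conj (\tr A).
  by rewrite mxtrace_tr rmorph_sum; apply: eq_bigr => i _; rewrite mxE.
rewrite /bweight; have [j0|j0] := eqVneq (j : nat) 0%N; last first.
  have [j'0|j'0] := eqVneq (j' : nat) 0%N.
    rewrite (G0 j'0) mulmx1 conj_tr Gtr // rmorph0 mulr0.
    by rewrite -val_eqE /= j'0 (negPf j0).
  by rewrite Gorth // mulrA mulVf ?mul1r // gt_eqF.
rewrite (G0 j0) /adjmx map_mx1 trmx1 mul1mx.
have [j'0|j'0] := eqVneq (j' : nat) 0%N.
  by rewrite (G0 j'0) mxtrace1 mulVf // -val_eqE /= j0 j'0.
by rewrite Gtr // mulr0 -val_eqE /= j0 eq_sym (negPf j'0).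
Qed.

(** Orthogonality says [U *m V = 1], where the rows of [U] are the vectorised basis matrices. As
    there are [d ^ 2] of them, [U] is square, so [V *m U = 1], which is completeness. *)
Lemma basis_complete (a b a' b' : 'I_d) :
  \sum_j bweight kappa j * (G j b a * Num.conj (G j b' a')) =
  ((b == b') && (a == a'))%:R.
Proof.
pose U : 'M[C]_(d ^ 2) := \matrix_j (mxvec (G j) : 'rV_(d ^ 2)).
pose V : 'M[C]_(d ^ 2) :=
  \matrix_(k, j) (bweight kappa j * Num.conj ((mxvec (G j) : 'rV_(d ^ 2)) 0 k)).
have UV : U *m V = 1%:M.
  apply/matrixP => j j'; rewrite !mxE -[in RHS]eq_sym -basis_gram.
  under eq_bigr do rewrite !mxE mulrCA.
  rewrite -mulr_sumr; congr (_ * _).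
  rewrite (reindex _ (curry_mxvec_bij d d)) /=.
  transitivity (\sum_(p : 'I_d * 'I_d) G j p.1 p.2 * Num.conj (G j' p.1 p.2)).
    by apply: eq_bigr => -[i k] _; rewrite /= !mxvecE.
  rewrite -(pair_bigA _ (fun i k => G j i k * Num.conj (G j' i k))) exchange_big.
  apply: eq_bigr => i _; rewrite mxE; apply: eq_bigr => k _.
  by rewrite !mxE mulrC.
have /matrixP/(_ (mxvec_index b' a') (mxvec_index b a)) := mulmx1C UV.
have -> : (1%:M : 'M[C]_(d ^ 2)) (mxvec_index b' a') (mxvec_index b a) =
    ((b == b') && (a == a'))%:R.
  have := mxvecE (delta_mx b' a' : 'M[C]_d) b a.
  by rewrite mxvec_delta !mxE eqxx /= eq_sym.
move=> <-; rewrite mxE; apply: eq_bigr => j _.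
by rewrite !mxE !mxvecE mulrAC mulrA.
Qed.

End BasisCompleteness.

Lemma sum_prod_dffun (C : comPzSemiRingType) (T : finType) (I_ : T -> finType)
    (f : forall l, I_ l -> C) :
  \sum_(i : {dffun forall l, I_ l}) \prod_l f l (i l) = \prod_l \sum_j f l j.
Proof.
rewrite (reindex (@dffun_of_fprod _ I_)); last first.
  exact/onW_bij/dffun_of_fprod_bij.
pose P l := [ffun j => f l j].
transitivity (\sum_(t : fprod I_) \prod_(l in T) P l (t l)).
  by apply: eq_bigr => t _; apply: eq_bigr => l _; rewrite !ffunE.
rewrite big_fprod -(bigA_distr_big_dep _ (fun l => untag 0 (P l))).
apply: eq_bigr => l _.
rewrite -(big_tag P l); apply: eq_bigr => j _; exact: ffunE.
Qed.

Lemma prod_natb (C : comPzSemiRingType) (T : finType) (b : T -> bool) :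
  \prod_l (b l)%:R = [forall l, b l]%:R :> C.
Proof.
case: forallP => [bT|/forallP]; first by rewrite big1 // => l _; rewrite bT.
by rewrite negb_forall => /existsP[l bl]; rewrite (bigD1 l) //= (negPf bl) mul0r.
Qed.

(** * Correlation weights and marginal purities of a pure state *)

Section PureState.
Variables (C : numClosedFieldType) (T : finType) (d : T -> nat) (kappa : T -> C).
Variable G : forall l, 'I_(d l ^ 2) -> 'M[C]_(d l).
Hypothesis kappa_gt0 : forall l, 0 < kappa l.
Hypothesis G0 : forall l (j : 'I_(d l ^ 2)), (j : nat) = 0%N -> G j = 1%:M.
Hypothesis Gtr : forall l (j : 'I_(d l ^ 2)), (j : nat) != 0%N -> \tr (G j) = 0.
Hypothesis Gorth : forall l (j j' : 'I_(d l ^ 2)), (j : nat) != 0%N -> (j' : nat) != 0%N ->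
  \tr (adjmx (G j) *m G j') = kappa l * (j == j')%:R.

Local Notation I := {dffun forall l : T, 'I_(d l)}.
Local Notation J := {dffun forall l : T, 'I_(d l ^ 2)}.

Variable psi : I -> C.
Hypothesis psi_unit : \sum_a psi a * Num.conj (psi a) = 1.

(** The expectation value of the tensor product of the [G (i l)] in the state |psi><psi|. *)
Definition pure_exp (psi : I -> C) (i : J) : C :=
  \sum_a \sum_b psi a * Num.conj (psi b) * \prod_l G (i l) (b l) (a l).

Definition dsupp (i : J) : {set T} := [set l | (i l : nat) != 0%N].

Let f (p : I * I) : C := psi p.1 * Num.conj (psi p.2).

(** Here [p] and [q] index entries of two copies of |psi><psi|. On [B] the indices are matched
    between the copies; outside [B] each copy is traced out. *)
Let link (B : {set T}) (p q : I * I) (l : T) : bool :=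
  if l \in B then (p.1 l == q.1 l) && (p.2 l == q.2 l)
  else (p.1 l == p.2 l) && (q.1 l == q.2 l).

(* [purity B] is Tr(rho_B ^ 2) for the marginal [rho_B] of |psi><psi|. *)
Definition purity (B : {set T}) : C :=
  \sum_p \sum_q f p * Num.conj (f q) * \prod_l (link B p q l)%:R.

(** Exchanging the column index of [p] with the row index of [q] swaps the two kinds of links. It
    preserves [f p * Num.conj (f q)] because [f] is the rank-one product of [psi] with its
    conjugate. *)
Lemma purityC B : purity B = purity (~: B).
Proof.
rewrite /purity !(pair_bigA _ (fun p q => _)) /=.
pose sw (z : (I * I) * (I * I)) := ((z.1.1, z.2.1), (z.1.2, z.2.2)).
have swK : involutive sw by case=> [[? ?] [? ?]].
rewrite (reindex_inj (inv_inj swK)); apply: eq_bigr => -[[a b] [a' b']] _ /=.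
congr (_ * _); first by rewrite /f /= !rmorphM /= !conjCK; ring.
apply: eq_bigr => l _; rewrite /link /= in_setC; case: ifP => _ //=.
Qed.

Lemma link_all0 p q :
  \prod_l (link set0 p q l)%:R = (p.1 == p.2)%:R * (q.1 == q.2)%:R :> C.
Proof.
rewrite prod_natb -natrM mulnb; congr (nat_of_bool _)%:R.
apply/forallP/andP => [h|[/eqP e1 /eqP e2] l]; last first.
  by rewrite /link inE e1 e2 !eqxx.
by split; apply/eqP/ffunP => l; have := h l; rewrite /link inE => /andP[/eqP ? /eqP].
Qed.

Lemma purity0 : purity set0 = 1.
Proof.
have diag1 : \sum_p f p * (p.1 == p.2)%:R = 1.
  rewrite -[RHS]psi_unit -(pair_bigA _ (fun a b => psi a * Num.conj (psi b) * (a == b)%:R)) /=.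
  apply: eq_bigr => a _; rewrite (bigD1 a) //= eqxx mulr1 big1 ?addr0 // => b ba.
  by rewrite eq_sym (negPf ba) mulr0.
transitivity ((\sum_p f p * (p.1 == p.2)%:R) *
    Num.conj (\sum_p f p * (p.1 == p.2)%:R)); last first.
  by rewrite diag1 rmorph1 mulr1.
rewrite rmorph_sum big_distrlr /=; apply: eq_bigr => p _; apply: eq_bigr => q _.
by rewrite link_all0 [Num.conj (_ * _%:R)]rmorphM rmorph_nat /=; ring.
Qed.

(** On [B] this is completeness of the local basis; outside [B] only the identity survives, with
    weight [1 / d l]. *)
Lemma local_sum (B : {set T}) (l : T) (p q : I * I) :
  \sum_(j : 'I_(d l ^ 2)) (((l \in B) || ((j : nat) == 0%N))%:R * bweight (kappa l) j) *
     (G j (p.2 l) (p.1 l) * Num.conj (G j (q.2 l) (q.1 l))) =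
  (if l \in B then 1 else (d l)%:R^-1) * (link B p q l)%:R.
Proof.
rewrite /link; case: ifP => lB /=.
  under eq_bigr do rewrite mul1r.
  rewrite (basis_complete (kappa_gt0 l) (@G0 l) (@Gtr l) (@Gorth l)).
  by rewrite andbC mul1r.
have z : (0 < d l ^ 2)%N by rewrite expn_gt0 (leq_ltn_trans _ (ltn_ord (p.1 l))).
rewrite (bigD1 (Ordinal z)) //= mul1r /bweight /= big1 ?addr0; last first.
  by move=> j j0; rewrite -val_eqE /= in j0; rewrite (negPf j0) !mul0r.
rewrite G0 // !mxE rmorph_nat -natrM mulnb; congr (_ * (nat_of_bool (_ && _))%:R).
  exact: eq_sym.
exact: eq_sym.
Qed.

Let W (i : J) : C := \prod_l bweight (kappa l) (i l).

Lemma sum_sub_purity (B : {set T}) :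
  \sum_(i | dsupp i \subset B) W i * `|pure_exp psi i| ^+ 2 =
  (\prod_(l in ~: B) (d l)%:R^-1) * purity B.
Proof.
rewrite big_mkcond /=.
(* The support condition is encoded as a product of local indicators, so that the sum over [i]
   factorises over the parties into the sums of [local_sum]. *)
pose wB (i : J) : C :=
  \prod_l (((l \in B) || ((i l : nat) == 0%N))%:R * bweight (kappa l) (i l)).
transitivity (\sum_(i : J) wB i * `|pure_exp psi i| ^+ 2).
  apply: eq_bigr => i _; rewrite /wB big_split /= prod_natb.
  have -> : [forall l, (l \in B) || ((i l : nat) == 0%N)] = (dsupp i \subset B).
    apply/forallP/subsetP => [h l|h l].
      by rewrite inE => /negPf il; have := h l; rewrite il orbF.
    by have [//|/negPf il] := boolP (l \in B); apply: contraFT il => /= il; apply: h; rewrite inE.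
  by case: ifP; rewrite ?mul1r ?mul0r.
have expE (i : J) : pure_exp psi i = \sum_p f p * \prod_l G (i l) (p.2 l) (p.1 l).
  by rewrite /pure_exp (pair_bigA _ (fun a b => _)).
transitivity (\sum_(i : J) \sum_p \sum_q f p * Num.conj (f q) *
   \prod_l ((((l \in B) || ((i l : nat) == 0%N))%:R * bweight (kappa l) (i l)) *
     (G (i l) (p.2 l) (p.1 l) * Num.conj (G (i l) (q.2 l) (q.1 l))))).
  apply: eq_bigr => i _; rewrite normCK expE rmorph_sum big_distrlr /= mulr_sumr.
  apply: eq_bigr => p _; rewrite mulr_sumr; apply: eq_bigr => q _.
  by rewrite rmorphM rmorph_prod /= big_split /= -/(wB i) big_split /=; ring.
rewrite exchange_big mulr_sumr; apply: eq_bigr => p _.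
rewrite exchange_big mulr_sumr; apply: eq_bigr => q _ /=.
rewrite -mulr_sumr mulrCA; congr (_ * _).
rewrite (@sum_prod_dffun _ _ (fun l => 'I_(d l ^ 2) : finType)
  (fun l j => (((l \in B) || ((j : nat) == 0%N))%:R * bweight (kappa l) j) *
     (G j (p.2 l) (p.1 l) * Num.conj (G j (q.2 l) (q.1 l))))).
under eq_bigr do rewrite local_sum.
rewrite big_split /=; congr (_ * _).
rewrite [RHS]big_mkcond /=; apply: eq_bigr => l _; rewrite in_setC.
by case: (l \in B).
Qed.

(** If there were no index at all, the norm of [psi] would be an empty sum. *)
Lemma dim_gt0 l : (0 < d l)%N.
Proof.
have [a _|I0] := pickP (predT : pred I); first exact: leq_ltn_trans (ltn_ord (a l)).
move: psi_unit; rewrite big_pred0 // => /eqP.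
by rewrite eq_sym oner_eq0.
Qed.

Let D : C := \prod_l (d l)%:R.

(** The factor [D] turns the inverse dimensions outside [B] in [sum_sub_purity] into the dimensions
    inside [B], as [sum_corr_weight] requires. *)
Definition corr_weight (A : {set T}) : C :=
  D * \sum_(i | dsupp i == A) W i * `|pure_exp psi i| ^+ 2.

Lemma corr_weight_ge0 A : 0 <= corr_weight A.
Proof.
rewrite mulr_ge0 ?prodr_ge0 //; apply: sumr_ge0 => i _.
rewrite mulr_ge0 ?exprn_ge0 //; apply: prodr_ge0 => l _.
by rewrite /bweight; case: ifP => _; rewrite invr_ge0 // ltW.
Qed.

Lemma sum_corr_weight (B : {set T}) :
  \sum_(A : {set T} | A \subset B) corr_weight A =
  (\prod_(l in B) (d l)%:R) * purity B.
Proof.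
rewrite -mulr_sumr (exchange_big_dep (fun i => dsupp i \subset B)) /=; last first.
  by move=> A i AB /eqP ->.
under eq_bigr => i iB.
  rewrite (big_pred1 (dsupp i)) => [|A]; last first.
    by rewrite /= [RHS]eq_sym; case: (dsupp i =P A) => [<-|]; rewrite ?iB ?andbF.
  over.
rewrite sum_sub_purity mulrA; congr (_ * _).
rewrite /D (bigID (mem B)) /= -mulrA.
rewrite [X in _ * (_ * X)](eq_bigl (fun l => l \notin B)); last by move=> l; rewrite in_setC.
rewrite -big_split /= [X in _ * X]big1 ?mulr1 // => l _.
by rewrite mulfV // pnatr_eq0 -lt0n dim_gt0.
Qed.

Lemma sum_pure_exp0 : \sum_(i | dsupp i == set0) pure_exp psi i = 1.
Proof.
have z l : (0 < d l ^ 2)%N by rewrite expn_gt0 dim_gt0.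
pose i0 : J := [ffun l => Ordinal (z l)].
rewrite (big_pred1 i0) => [|i]; last first.
  rewrite -subset0; apply/subsetP/eqP => [h|-> l]; last by rewrite inE !ffunE.
  apply/ffunP => l; apply: val_inj; rewrite !ffunE /=; apply/eqP/negPn/negP => il.
  by have := h l; rewrite !inE => /(_ il).
rewrite -[RHS]psi_unit; apply: eq_bigr => a _.
rewrite (bigD1 a) //= big1 ?mulr1 => [|l _]; last by rewrite G0 ?ffunE // mxE eqxx.
rewrite big1 ?addr0 // => b ba.
suff -> : \prod_l G (i0 l) (b l) (a l) = 0 by rewrite mulr0.
have [l bl] : exists l, b l != a l.
  apply/existsP; rewrite -negb_forall; apply: contra ba => /forallP h.
  by apply/eqP/ffunP => l; exact/eqP/h.
by rewrite (bigD1 l) //= G0 ?ffunE // mxE (negPf bl) mul0r.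
Qed.

Definition pure_corr (psi : I -> C) (i : J) : C :=
  (\prod_(l | (i l : nat) != 0%N) ((d l)%:R / kappa l)) * pure_exp psi i.

(** This is the trace of the state: the factor contributed by the group of parties on which a
    correlation tensor acts trivially. *)
Lemma sum_pure_corr0 : \sum_(i | dsupp i == set0) pure_corr psi i = 1.
Proof.
rewrite -[RHS]sum_pure_exp0; apply: eq_bigr => i /eqP i0.
rewrite /pure_corr big_pred0 ?mul1r // => l.
by have := in_set0 l; rewrite -i0 inE.
Qed.

(** On full support every local weight is [1 / kappa l], so the squared prefactor [(D / K) ^ 2]
    equals [D / K] times [D] times the weight [W i]. *)
Lemma sum_pure_corr_full :
  \sum_(i | dsupp i == setT) `|pure_corr psi i| ^+ 2 =
  D / (\prod_l kappa l) * corr_weight setT.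
Proof.
rewrite /corr_weight mulrA mulr_sumr; apply: eq_bigr => i /eqP iT.
rewrite /pure_corr normrM exprMn mulrA; congr (_ * _).
have il l : (i l : nat) != 0%N by have := in_setT l; rewrite -iT inE.
rewrite (eq_bigl predT) // prodf_div -/D.
have -> : W i = (\prod_l kappa l)^-1.
  by rewrite -prodfV; apply: eq_bigr => l _; rewrite /bweight (negPf (il l)).
rewrite ger0_norm; first by ring.
by rewrite divr_ge0 ?prodr_ge0 // => l _; exact: ltW.
Qed.

Let dR l : C := (d l)%:R.

Lemma pure_corr_le :
  let t : C := #|T|%:R in
  let sinv : C := \sum_l ((d l)%:R ^+ 2)^-1 in
  let DK := D / \prod_l kappa l in
  let S2 := \sum_(i | dsupp i == setT) `|pure_corr psi i| ^+ 2 in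
  [/\ #|T| = 1%N -> S2 <= DK * (D - 1),
      (2 <= #|T|)%N -> S2 <= DK * (D + 1 / (t - 1) - D / (t - 1) * sinv) &
      (3 <= #|T|)%N -> (forall l, 1 <= D * ((d l)%:R ^+ 2)^-1) ->
      S2 <= DK * (D + 2 / (t - 2) - D / (t - 2) * sinv)].
Proof.
move=> t sinv DK S2.
have dR_gt0 l : 0 < dR l by rewrite ltr0n dim_gt0.
have DK_ge0 : 0 <= DK by rewrite divr_ge0 ?prodr_ge0 // => l _; exact: ltW.
have S2E : S2 = DK * corr_weight setT by exact: sum_pure_corr_full.
have aQ := sum_corr_weight; have pos := corr_weight_ge0.
rewrite S2E; split=> [T1|T2|T3 Dd]; apply: ler_wpM2l => //.
- by rewrite (weightT_one (d := dR) aQ purityC purity0 T1).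
- exact: (weightT_le dR_gt0 pos aQ purityC purity0 T2).
- exact: (weightT_le_large dR_gt0 pos aQ purityC purity0 T3 Dd).
Qed.

End PureState.

(** * Splitting the parties along a bipartition *)

Section Glue.
Variables (N : nat) (e : 'I_N -> nat) (Rs : {set 'I_N}).

(** An informative sum, since [glue] needs the membership proof to form an element of the
    subtype. *)
Lemma in_or_setC (l : 'I_N) : {l \in Rs} + {l \in ~: Rs}.
Proof. by case E: (l \in Rs); [left | right; rewrite in_setC E]. Qed.

Definition glue (a : SubIdx e Rs) (b : SubIdx e (~: Rs)) : Idx e :=
  @finfun _ (fun l => 'I_(e l)) (fun l =>
    match in_or_setC l with
    | left h => a (exist _ l h)
    | right h => b (exist _ l h)
    end).

Lemma restr_glue a b : (restr Rs (glue a b), restr (~: Rs) (glue a b)) = (a, b).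
Proof.
congr pair; apply/ffunP => -[l h]; rewrite !ffunE /=.
  case: in_or_setC => h1; first by congr (a (exist _ _ _)); exact: bool_irrelevance.
  by exfalso; move: (h1); rewrite in_setC h.
case: in_or_setC => h1; last by congr (b (exist _ _ _)); exact: bool_irrelevance.
by exfalso; move: (h); rewrite in_setC h1.
Qed.

Lemma glue_restr a : glue (restr Rs a) (restr (~: Rs) a) = a.
Proof. by apply/ffunP => l; rewrite ffunE; case: in_or_setC => h; rewrite ffunE. Qed.

Lemma sum_glue (V : nmodType) (F : SubIdx e Rs -> SubIdx e (~: Rs) -> V) :
  \sum_(a : Idx e) F (restr Rs a) (restr (~: Rs) a) = \sum_a \sum_b F a b.
Proof.
rewrite pair_bigA (reindex (fun a : Idx e => (restr Rs a, restr (~: Rs) a))) //=.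
exists (fun z => glue z.1 z.2) => [a _|[a b] _]; first exact: glue_restr.
exact: restr_glue.
Qed.

Lemma sum_glue_cond (C : pzSemiRingType) (P : pred (SubIdx e Rs))
    (Q : pred (SubIdx e (~: Rs))) F H :
  \sum_(a : Idx e | P (restr Rs a) && Q (restr (~: Rs) a))
     F (restr Rs a) * H (restr (~: Rs) a) =
  (\sum_(a | P a) F a) * (\sum_(b | Q b) H b) :> C.
Proof.
rewrite big_mkcond (sum_glue (fun a b => if P a && Q b then F a * H b else 0)).
rewrite big_distrlr /= [RHS]big_mkcond; apply: eq_bigr => a _.
by case: (P a) => /=; rewrite ?[RHS]big_mkcond // big1.
Qed.

Lemma prod_split (C : comPzSemiRingType) (P : pred 'I_N) (F : 'I_N -> C) :
  \prod_(l | P l) F l = (\prod_(l : {x | x \in Rs} | P (val l)) F (val l)) *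
    (\prod_(l : {x | x \in ~: Rs} | P (val l)) F (val l)).
Proof.
rewrite (bigID (mem Rs)) /=; congr (_ * _).
  by rewrite -big_sub_cond; apply: eq_bigl => l; rewrite andbC.
by rewrite -big_sub_cond; apply: eq_bigl => l; rewrite andbC in_setC.
Qed.
End Glue.

(** By injectivity each inner sum has at most one term, so the modulus can be taken inside. Indices
    with [k i >= m] lie in no fibre, whence an inequality. *)
Lemma sum_fiber_le (C : numClosedFieldType) (J : finType) (P : pred J) (k : J -> nat)
    (F : J -> C) (m : nat) :
  {in P &, injective k} ->
  \sum_(r < m) `|\sum_(i | P i && (k i == r)) F i| ^+ 2 <= \sum_(i | P i) `|F i| ^+ 2.
Proof.
move=> k_inj.
rewrite (eq_bigr (fun r : 'I_m => \sum_(i | P i && (k i == r)) `|F i| ^+ 2)); last first.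
  move=> r _; have [i0 /andP[Pi0 /eqP ki0]|none] := pickP (fun i => P i && (k i == r)).
    suff E : (fun i => P i && (k i == r)) =1 pred1 i0 by rewrite !(big_pred1 i0).
    move=> i; apply/andP/eqP => [[Pi /eqP ki]|->]; last by rewrite Pi0 ki0 eqxx.
    by apply: k_inj => //; rewrite ki.
  by rewrite !big_pred0 // normr0 expr0n.
rewrite (exchange_big_dep P) => [|r i _ /andP[] //] /=; apply: ler_sum => i Pi.
have [lt_km|le_mk] := ltnP (k i) m.
  rewrite (big_pred1 (Ordinal lt_km)) // => r.
  by rewrite /= Pi -val_eqE /= eq_sym.
rewrite big_pred0 ?exprn_ge0 // => r; rewrite Pi /=; apply: gtn_eqF.
exact: leq_trans le_mk.
Qed.

(** * Positions of tensor entries within one group of parties *)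

Section Parties.
Variables (N : nat) (d : 'I_N -> nat) (S : {set 'I_N}).

Lemma big_parties (C : Type) (idx : C) (op : Monoid.com_law idx) (F : 'I_N -> C) :
  \big[op/idx]_(l <- parties S) F l = \big[op/idx]_(l : {x | x \in S}) F (val l).
Proof. by rewrite big_filter big_enum_cond /= -big_sub. Qed.

Lemma size_parties : size (parties S) = #|S|.
Proof. by rewrite cardE /parties enumT /enum_mem; congr size; apply: eq_filter. Qed.

Lemma mem_parties l : (l \in parties S) = (l \in S).
Proof. by rewrite mem_filter mem_enum andbT. Qed.

(** The counterpart of [idxL] reading only the indices of parties in [S]; the default [0] is never
    reached, since [l] ranges over [parties S]. *)
Definition sub_idx (n : nat) (i : SubIdx (fun l => d l ^ 2)%N S) : nat :=
  mix_index n [seq (d l ^ 2 - 1)%N | l <- parties S]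
    [seq (if insub l is Some s then (i s : nat).-1 else 0%N) | l <- parties S].

Lemma idxL_restr n (i : Jdx d) : idxL n (parties S) i = sub_idx n (restr S i).
Proof.
congr mix_index; apply/eq_in_map => l; rewrite mem_parties => lS.
by rewrite insubT ffunE.
Qed.

(** On full support every index is at least [1], so its predecessor is a valid digit below
    [d l ^ 2 - 1] and determines it. *)
Lemma sub_idx_inj n : (n <= #|S|)%N ->
  {in (fun i => dsupp i == setT) &, injective (sub_idx n)}.
Proof.
move=> le_n i i' /eqP iT /eqP i'T.
have nz (k : SubIdx (fun l => d l ^ 2)%N S) s : dsupp k = setT -> (0 < k s)%N.
  by move=> kT; rewrite lt0n; have := in_setT s; rewrite -kT inE.
have insE l (lS : l \in S) : insub l = Some (exist _ l lS) :> option {x | x \in S}.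
  by rewrite insubT.
have bound (k : SubIdx (fun l => d l ^ 2)%N S) : dsupp k = setT ->
    forall s, (s < size [seq (d l ^ 2 - 1)%N | l <- parties S])%N ->
    (nth 0 [seq (if insub l is Some s then (k s : nat).-1 else 0) | l <- parties S] s <
     nth 0 [seq (d l ^ 2 - 1) | l <- parties S] s)%N.
  move=> kT s; rewrite size_map => lt_s.
  have x0 : 'I_N by case: (parties S) lt_s.
  rewrite !(nth_map x0) //; have := mem_nth x0 lt_s; rewrite mem_parties => lS.
  rewrite (insE _ lS); have := nz k (exist (fun x => x \in S) _ lS) kT.
  by have := ltn_ord (k (exist (fun x => x \in S) _ lS)); rewrite /=; lia.
move/(mix_index_inj _ _ _ (bound _ iT) (bound _ i'T)).
rewrite !size_map size_parties => /(_ le_n erefl erefl)/eq_in_map eq_ii'.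
apply/ffunP => -[l lS]; apply: val_inj; have := eq_ii' l.
rewrite mem_parties => /(_ lS); rewrite !(insE _ lS).
have := nz i (exist (fun x => x \in S) _ lS) iT.
have := nz i' (exist (fun x => x \in S) _ lS) i'T.
move=> /=; lia.
Qed.

End Parties.

(** * Norm bound for the full correlation tensor of a group of parties *)

Section CorrelationBound.
Variables (R : realType) (C : numClosedFieldType) (phi : {rmorphism R -> C}).
Hypothesis phi_le : {mono phi : x y / x <= y}.
Variables (N : nat) (d : 'I_N -> nat) (kappa : 'I_N -> R).
Variable G : forall l : 'I_N, 'I_(d l ^ 2) -> 'M[C]_(d l).
Hypothesis kappa_gt0 : forall l, 0 < kappa l.
Hypothesis G0 : forall l (j : 'I_(d l ^ 2)), (j : nat) = 0%N -> G j = 1%:M.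
Hypothesis Gtr : forall l (j : 'I_(d l ^ 2)), (j : nat) != 0%N -> \tr (G j) = 0.
Hypothesis Gorth : forall l (j j' : 'I_(d l ^ 2)), (j : nat) != 0%N -> (j' : nat) != 0%N ->
  \tr (adjmx (G j) *m G j') = phi (kappa l) * (j == j')%:R.
Variables (S : {set 'I_N}) (psi : SubIdx d S -> C).
Hypothesis psi_unit : \sum_a psi a * Num.conj (psi a) = 1.
Hypothesis S_gt0 : (0 < #|S|)%N.

Lemma phi_lt : {mono phi : x y / x < y}.
Proof. exact: leW_mono. Qed.

Lemma sum_sub_corr_le :
  \sum_(i | dsupp i == setT) `|@pure_corr C {x | x \in S} (fun l => d (val l))
     (fun l => phi (kappa (val l))) (fun l => @G (val l)) psi i| ^+ 2 <=
  phi (mfrak d kappa (parties S)).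
Proof.
have kgt0 l : 0 < phi (kappa l) by rewrite -(rmorph0 phi) phi_lt.
have [le1 le2 le3] := @pure_corr_le C {x | x \in S} (fun l => d (val l))
   (fun l => phi (kappa (val l))) (fun l => @G (val l)) (fun l => kgt0 (val l))
   (fun l => @G0 (val l)) (fun l => @Gtr (val l)) (fun l => @Gorth (val l))
   psi psi_unit.
have dpos l : l \in S -> (0 < d l)%N.
  by move=> lS; have := dim_gt0 psi_unit (exist (fun x => x \in S) l lS).
have cardT : #|{: {x | x \in S}}| = #|S| by rewrite card_sig.
rewrite /mfrak size_parties !big_parties.
set D := \prod_l (d (val l))%:R; set K := \prod_l kappa (val l).
set sinv := \sum_l _.
have DE : \prod_(l : {x | x \in S}) (d (val l))%:R = phi D.
  by rewrite rmorph_prod; apply: eq_bigr => l _; rewrite rmorph_nat.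
have KE : \prod_(l : {x | x \in S}) phi (kappa (val l)) = phi K.
  by rewrite rmorph_prod.
have sE : \sum_(l : {x | x \in S}) ((d (val l))%:R ^+ 2)^-1 = phi sinv.
  by rewrite rmorph_sum; apply: eq_bigr => l _; rewrite fmorphV rmorphXn rmorph_nat.
move: le1 le2 le3; rewrite /= cardT DE KE sE => le1 le2 le3.
have [S1|S1] := eqVneq #|S| 1%N.
  apply: le_trans (le1 S1) _.
  have -> : phi D / phi K * (phi D - 1) = (phi D ^+ 2 - phi D) / phi K by ring.
  by rewrite rmorphM rmorphB fmorphV rmorphXn.
have S2 : (2 <= #|S|)%N by rewrite ltn_neqAle eq_sym S1.
case: ifP => [_|/negbT].
  apply: le_trans (le2 S2) _.
  by rewrite !(rmorphM, rmorphB, rmorphD, fmorphV, rmorph1, rmorph_nat).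
rewrite negb_or -leNgt => /andP[S2' Dd].
have S3 : (3 <= #|S|)%N by rewrite ltn_neqAle eq_sym S2'.
apply: le_trans (le3 S3 _) _; last first.
  by rewrite !(rmorphM, rmorphB, rmorphD, fmorphV, rmorph1, rmorph_nat).
(* The ratio [D / d_l ^ 2] is smallest at the largest dimension, so the condition on the maximum
   covers every party. *)
move=> l; rewrite -(rmorph_nat phi) -rmorphXn -fmorphV -rmorphM -(rmorph1 phi) phi_le.
apply: le_trans Dd _; apply: ler_wpM2l; first by apply: prodr_ge0.
have dl : (0 < d (val l))%N by apply: dpos; exact: valP.
have le_max : (d (val l) <= \max_(l : {x | x \in S}) d (val l))%N by exact: leq_bigmax.
rewrite lef_pV2 ?posrE ?exprn_gt0 ?ltr0n //; last exact: leq_trans le_max.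
by rewrite ler_pXn2r ?nnegrE ?ler0n // ler_nat.
Qed.

Definition sub_vec (n : nat) : 'cV[C]_(dimL d (parties S)) :=
  \col_r \sum_(i | (dsupp i == setT) && (sub_idx n i == r))
    @pure_corr C {x | x \in S} (fun l => d (val l))
     (fun l => phi (kappa (val l))) (fun l => @G (val l)) psi i.

Lemma nrm2_sub_vec_le n : (n <= #|S|)%N ->
  nrm2 (sub_vec n) <= phi (mfrak d kappa (parties S)).
Proof.
move=> le_n; apply: le_trans sum_sub_corr_le; rewrite /nrm2.
under eq_bigr do rewrite mxE.
by apply: sum_fiber_le; exact: sub_idx_inj.
Qed.

End CorrelationBound.

(** * The block matrix as a convex combination of rank-one matrices *)

Section RankOneBlocks.
Variables (C : comPzRingType) (K : nat) (p : 'I_K -> C).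
Hypothesis p_sum1 : \sum_j p j = 1.

Lemma scale_sum_const m n (A : 'M[C]_(m, n)) : A = \sum_j p j *: A.
Proof. by rewrite -scaler_suml p_sum1 scale1r. Qed.

Lemma tensmx_sum m n m' n' (A : 'M[C]_(m, n)) (B : 'I_K -> 'M[C]_(m', n')) :
  tensmx A (\sum_j p j *: B j) = \sum_j p j *: tensmx A (B j).
Proof.
apply/matrixP => i k; rewrite mxE !summxE mulr_sumr; apply: eq_bigr => j _.
by rewrite !mxE mulrCA.
Qed.

Lemma block_mx_sum m1 m2 n1 n2 (A : 'I_K -> 'M[C]_(m1, n1)) (B : 'I_K -> 'M[C]_(m1, n2))
    (A' : 'I_K -> 'M[C]_(m2, n1)) (B' : 'I_K -> 'M[C]_(m2, n2)) :
  block_mx (\sum_j p j *: A j) (\sum_j p j *: B j)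
    (\sum_j p j *: A' j) (\sum_j p j *: B' j) =
  \sum_j p j *: block_mx (A j) (B j) (A' j) (B' j).
Proof.
apply/matrixP => a k; rewrite summxE.
rewrite -[a]splitK -[k]splitK; case: (split a) => a'; case: (split k) => k' /=.
- by rewrite block_mxEul summxE; apply: eq_bigr => j _; rewrite mxE [RHS]mxE block_mxEul.
- by rewrite block_mxEur summxE; apply: eq_bigr => j _; rewrite mxE [RHS]mxE block_mxEur.
- by rewrite block_mxEdl summxE; apply: eq_bigr => j _; rewrite mxE [RHS]mxE block_mxEdl.
- by rewrite block_mxEdr summxE; apply: eq_bigr => j _; rewrite mxE [RHS]mxE block_mxEdr.
Qed.

(** The constant corner enters the sum because the weights add up to [1], the off-diagonal blocks
    are linear in [x] or [y], and the last block splits by the mixed-product rule for Kronecker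
    products. *)
Lemma block_rank1_sum p1 p2 q1 q2 D1 D2 (u : 'cV[C]_p1) (v : 'cV[C]_p2)
    (al : 'cV[C]_q1) (be : 'cV[C]_q2) (x : 'I_K -> 'cV[C]_D1) (y : 'I_K -> 'cV[C]_D2) :
  block_mx (u *m v^T) (u *m (tensmx be (\sum_j p j *: y j))^T)
    (tensmx al (\sum_j p j *: x j) *m v^T)
    (tensmx (al *m be^T) (\sum_j p j *: (x j *m (y j)^T))) =
  \sum_j p j *: ((col_mx u (tensmx al (x j) : 'cV_(q1 * D1))) *m
                 (col_mx v (tensmx be (y j) : 'cV_(q2 * D2)))^T).
Proof.
under [RHS]eq_bigr do rewrite tr_col_mx mul_col_row.
rewrite -block_mx_sum; congr block_mx.
- exact: scale_sum_const.
- rewrite tensmx_sum linear_sum mulmx_sumr; apply: eq_bigr => j _.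
  by rewrite linearZ -scalemxAr.
- rewrite tensmx_sum mulmx_suml; apply: eq_bigr => j _.
  by rewrite -scalemxAl.
- rewrite tensmx_sum; apply: eq_bigr => j _.
  by rewrite -tensmx_mul -trmx_tens.
Qed.

End RankOneBlocks.

(** * Factorisation of correlations across the bipartition *)

Section ProductState.
Variables (C : numClosedFieldType) (N : nat) (d : 'I_N -> nat) (kappa : 'I_N -> C).
Variable G : forall l : 'I_N, 'I_(d l ^ 2) -> 'M[C]_(d l).
Variable Rs : {set 'I_N}.

Definition sub_corr (S : {set 'I_N}) (psi : SubIdx d S -> C)
    (i : SubIdx (fun l => d l ^ 2)%N S) : C :=
  @pure_corr C {x | x \in S} (fun l => d (val l)) (fun l => kappa (val l))
    (fun l => @G (val l)) psi i.

Definition restrJ (S : {set 'I_N}) (i : Jdx d) : SubIdx (fun l => d l ^ 2)%N S :=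
  @restr N (fun l => d l ^ 2)%N S i.

Lemma product_corr (psi : SubIdx d Rs -> C) (phi : SubIdx d (~: Rs) -> C) (i : Jdx d) :
  (\prod_(l : 'I_N | (i l : nat) != 0%N) ((d l)%:R / kappa l)) *
  (\sum_(a : Idx d) \sum_(b : Idx d)
     ((psi (restr Rs a) * phi (restr (~: Rs) a)) *
      Num.conj (psi (restr Rs b) * phi (restr (~: Rs) b))) *
     \prod_(l : 'I_N) G (i l) (b l) (a l)) =
  sub_corr psi (restrJ Rs i) * sub_corr phi (restrJ (~: Rs) i).
Proof.
pose g S (a b : SubIdx d S) : C :=
  \prod_(l : {x | x \in S}) G (i (val l)) (b l) (a l).
have corrE S (xi : SubIdx d S -> C) : sub_corr xi (restrJ S i) =
    (\prod_(l : {x | x \in S} | (i (val l) : nat) != 0%N) ((d (val l))%:R / kappa (val l))) *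
    \sum_a \sum_b (xi a * Num.conj (xi b) * g S a b).
  rewrite /sub_corr /pure_corr; congr (_ * _).
    by apply: eq_bigl => l; rewrite ffunE.
  apply: eq_bigr => a _; apply: eq_bigr => b _; congr (_ * _).
  by apply: eq_bigr => l _; rewrite ffunE.
rewrite !corrE (prod_split Rs) mulrACA; congr (_ * _).
pose Phi a' a'' b' b'' := (psi a' * Num.conj (psi b') * g Rs a' b') *
  (phi a'' * Num.conj (phi b'') * g (~: Rs) a'' b'').
transitivity (\sum_(a : Idx d) \sum_(b : Idx d)
   Phi (restr Rs a) (restr (~: Rs) a) (restr Rs b) (restr (~: Rs) b)).
  apply: eq_bigr => a _; apply: eq_bigr => b _.
  have -> : \prod_(l : 'I_N) G (i l) (b l) (a l) =
      g Rs (restr Rs a) (restr Rs b) * g (~: Rs) (restr (~: Rs) a) (restr (~: Rs) b).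
    rewrite (prod_split Rs); congr (_ * _); by apply: eq_bigr => l _; rewrite !ffunE.
  by rewrite /Phi rmorphM /=; ring.
under eq_bigr => a _.
  rewrite (sum_glue (Phi (restr Rs a) (restr (~: Rs) a))).
  over.
rewrite (sum_glue (fun a a' => \sum_b \sum_b' Phi a a' b b')) /=.
rewrite big_distrlr /=; apply: eq_bigr => a _; apply: eq_bigr => a' _.
by rewrite big_distrlr.
Qed.

Lemma supp_restr (X : {set 'I_N}) (i : Jdx d) :
  (supp i == X) = (dsupp (restrJ Rs i) == [set l | val l \in X]) &&
                  (dsupp (restrJ (~: Rs) i) == [set l | val l \in X]).
Proof.
apply/eqP/andP => [<-|[/eqP/setP hR /eqP/setP hC]].
  by split; apply/eqP/setP => l; rewrite !inE ffunE.
apply/setP => l; rewrite inE.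
have [h|h] := in_or_setC Rs l.
  by have := hR (exist (fun x => x \in Rs) l h); rewrite !inE ffunE.
by have := hC (exist (fun x => x \in ~: Rs) l h); rewrite !inE ffunE.
Qed.

Lemma supp_eqT (i : Jdx d) : (supp i == setT) =
  (dsupp (restrJ Rs i) == setT) && (dsupp (restrJ (~: Rs) i) == setT).
Proof.
by rewrite supp_restr; congr (_ && _); congr eq_op; apply/setP => l; rewrite !inE.
Qed.

Lemma supp_eqR (i : Jdx d) : (supp i == Rs) =
  (dsupp (restrJ Rs i) == setT) && (dsupp (restrJ (~: Rs) i) == set0).
Proof.
rewrite supp_restr; congr (_ && _); congr eq_op; apply/setP => -[l h].
  by rewrite !inE /= h.
by rewrite !inE /=; move: (h); rewrite in_setC => /negPf.
Qed.

Lemma supp_eqC (i : Jdx d) : (supp i == ~: Rs) =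
  (dsupp (restrJ Rs i) == set0) && (dsupp (restrJ (~: Rs) i) == setT).
Proof.
rewrite supp_restr; congr (_ && _); congr eq_op; apply/setP => -[l h].
  by rewrite !inE /= h.
by rewrite inE /= h inE.
Qed.

End ProductState.

(** * Correlations of a biseparable state *)

Section Biseparable.
Variables (R : realType) (N : nat) (d : 'I_N -> nat) (kappa : 'I_N -> R).
Variable G : forall l : 'I_N, 'I_(d l ^ 2) -> 'M[R[i]]_(d l).
Variables (Rs : {set 'I_N}) (rho : Idx d -> Idx d -> R[i]).
Variables (K : nat) (p : 'I_K -> R) (psi : 'I_K -> SubIdx d Rs -> R[i])
  (phi : 'I_K -> SubIdx d (~: Rs) -> R[i]).
Hypothesis rhoE : forall a b : Idx d, rho a b =
  \sum_j Cof (p j) * (psi j (restr Rs a) * phi j (restr (~: Rs) a))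
     * Num.conj (psi j (restr Rs b) * phi j (restr (~: Rs) b)).

Let tc S xi i := @sub_corr _ N d (fun l => Cof (kappa l)) G S xi i.

Lemma corr_biseparable (i : Jdx d) : corr kappa G rho i =
  \sum_j Cof (p j) * (tc (psi j) (restrJ Rs i) * tc (phi j) (restrJ (~: Rs) i)).
Proof.
rewrite /corr.
have -> : Cof (\prod_(l : 'I_N | (i l : nat) != 0%N) ((d l)%:R / kappa l)) =
    \prod_(l : 'I_N | (i l : nat) != 0%N) ((d l)%:R / Cof (kappa l)).
  rewrite /Cof rmorph_prod; apply: eq_bigr => l _.
  by rewrite rmorphM fmorphV rmorph_nat.
under [RHS]eq_bigr => j _ do rewrite -product_corr mulrCA mulr_sumr.
rewrite -mulr_sumr; congr (_ * _); rewrite [RHS]exchange_big /=; apply: eq_bigr => a _.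
under [RHS]eq_bigr => j _ do rewrite mulr_sumr.
rewrite [RHS]exchange_big /=; apply: eq_bigr => b _.
rewrite rhoE mulr_suml; apply: eq_bigr => j _.
by rewrite !mulrA.
Qed.

(** One statement for the three tensor blocks: [P] and [Q] prescribe full support at a given
    position, or empty support, on either side. *)
Lemma sum_corr_biseparable (P : pred (SubIdx (fun l => d l ^ 2)%N Rs))
    (Q : pred (SubIdx (fun l => d l ^ 2)%N (~: Rs))) (cond : pred (Jdx d)) :
  (forall i, cond i = P (restrJ Rs i) && Q (restrJ (~: Rs) i)) ->
  \sum_(i : Jdx d | cond i) corr kappa G rho i =
  \sum_j Cof (p j) * ((\sum_(i | P i) tc (psi j) i) * (\sum_(i | Q i) tc (phi j) i)).
Proof.
move=> condE; under eq_bigr do rewrite corr_biseparable.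
rewrite exchange_big /=; apply: eq_bigr => j _; rewrite -mulr_sumr; congr (_ * _).
by rewrite -(sum_glue_cond P Q) (eq_bigl _ _ condE).
Qed.

End Biseparable.

Lemma set_parties N (S : {set 'I_N}) : [set l | l \in parties S] = S.
Proof. by apply/setP => l; rewrite inE mem_parties. Qed.

Lemma nrm2_cmx (R : realType) q (u : 'cV[R]_q) : nrm2 (cmx u) = Cof (sqnorm u).
Proof.
rewrite /Cof rmorph_sum; apply: eq_bigr => l _.
by rewrite mxE -add_Re2_Im2 /= expr0n addr0.
Qed.

Theorem theorem4 (R : realType) (N : nat) (d : 'I_N -> nat) (kappa : 'I_N -> R)
  (G : forall l : 'I_N, 'I_(d l ^ 2) -> 'M[R[i]]_(d l))
  (HG0 : forall (l : 'I_N) (j : 'I_(d l ^ 2)), (j : nat) = 0%N -> G l j = 1%:M)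
  (HGtr : forall (l : 'I_N) (j : 'I_(d l ^ 2)), (j : nat) != 0%N -> \tr (G l j) = 0)
  (HGorth : forall (l : 'I_N) (j j' : 'I_(d l ^ 2)), (j : nat) != 0%N -> (j' : nat) != 0%N ->
     \tr (conjT (G l j) *m G l j') = Cof (kappa l) * (j == j')%:R)
  (Hkappa : forall l : 'I_N, 1 <= kappa l)
  (HN : (2 <= N)%N)
  (Rs : {set 'I_N})
  (HRs : (0 < #|Rs| < N)%N)
  (HRs0 : forall l : 'I_N, (l : nat) = 0%N -> l \in Rs)
  (n m : nat) (Hn : (1 <= n <= #|Rs|)%N) (Hm : (1 <= m <= N - #|Rs|)%N)
  (p1 p2 q1 q2 : nat) (Hp1 : (0 < p1)%N) (Hp2 : (0 < p2)%N) (Hq1 : (0 < q1)%N) (Hq2 : (0 < q2)%N)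
  (u : 'cV[R]_p1) (v : 'cV[R]_p2) (alpha : 'cV[R]_q1) (beta : 'cV[R]_q2)
  (rho : Idx d -> Idx d -> R[i]) :
  biseparable Rs rho ->
  trnorm_le (Mmat kappa G rho Rs n m u v alpha beta)
    (Num.sqrt (sqnorm u + sqnorm alpha * mfrak d kappa (parties Rs)) *
     Num.sqrt (sqnorm v + sqnorm beta * mfrak d kappa (parties (~: Rs)))).

Proof.
move=> [K [p [psi [phi [p_ge0 p_sum1 psi1 phi1 rhoE]]]]].
have kgt0 l : 0 < kappa l by exact: lt_le_trans (Hkappa l).
have emb_le : {mono (real_complex R) : x y / x <= y} by exact: lecR.
pose emb : {rmorphism R -> R[i]} := real_complex R.
have cardC : #|~: Rs| = (N - #|Rs|)%N by rewrite cardsCs setCK card_ord.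
have cardC0 : (0 < #|~: Rs|)%N by rewrite cardC subn_gt0; case/andP: HRs.
have card0 : (0 < #|Rs|)%N by case/andP: HRs.
have le_m : (m <= #|~: Rs|)%N by rewrite cardC; case/andP: Hm.
have le_n : (n <= #|Rs|)%N by case/andP: Hn.
pose x j := sub_vec emb kappa G (psi j) n.
pose y j := sub_vec emb kappa G (phi j) m.
have x_le j : nrm2 (x j) <= Cof (mfrak d kappa (parties Rs)).
  exact: (nrm2_sub_vec_le emb_le kgt0 HG0 HGtr HGorth (psi1 j) card0 le_n).
have y_le j : nrm2 (y j) <= Cof (mfrak d kappa (parties (~: Rs))).
  exact: (nrm2_sub_vec_le emb_le kgt0 HG0 HGtr HGorth (phi1 j) cardC0 le_m).
have z_psi j : \sum_(i | dsupp i == set0)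
    sub_corr (fun l => Cof (kappa l)) G (psi j) i = 1.
  exact: (sum_pure_corr0 _ (fun l => @HG0 (val l)) (psi1 j)).
have z_phi j : \sum_(i | dsupp i == set0)
    sub_corr (fun l => Cof (kappa l)) G (phi j) i = 1.
  exact: (sum_pure_corr0 _ (fun l => @HG0 (val l)) (phi1 j)).
(* Support [Rs] means full support on [Rs] and empty support on the complement, where [z_phi] gives
   the factor [1]. *)
have vecR : vecT kappa G rho n (parties Rs) = \sum_j Cof (p j) *: x j.
  apply/matrixP => r c; rewrite mxE summxE.
  rewrite (sum_corr_biseparable kappa G rhoE
    (P := fun i => (dsupp i == setT) && (sub_idx n i == r))
    (Q := fun i => dsupp i == set0)); last first.
    by move=> i; rewrite set_parties supp_eqR idxL_restr andbAC.
  by apply: eq_bigr => j _; rewrite z_phi mulr1 !mxE.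
have vecC : vecT kappa G rho m (parties (~: Rs)) = \sum_j Cof (p j) *: y j.
  apply/matrixP => r c; rewrite mxE summxE.
  rewrite (sum_corr_biseparable kappa G rhoE (P := fun i => dsupp i == set0)
    (Q := fun i => (dsupp i == setT) && (sub_idx m i == r))); last first.
    by move=> i; rewrite set_parties supp_eqC idxL_restr andbA.
  by apply: eq_bigr => j _; rewrite z_psi mul1r !mxE.
have unf : unfoldT kappa G rho n m (parties Rs) (parties (~: Rs)) =
    \sum_j Cof (p j) *: (x j *m (y j)^T).
  apply/matrixP => r c; rewrite mxE summxE.
  rewrite (sum_corr_biseparable kappa G rhoE
    (P := fun i => (dsupp i == setT) && (sub_idx n i == r))
    (Q := fun i => (dsupp i == setT) && (sub_idx m i == c))); last first.
    by move=> i; rewrite (supp_eqT Rs) !idxL_restr -!andbA; congr (_ && _); rewrite andbCA.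
  by apply: eq_bigr => j _; rewrite !mxE big_ord1 !mxE.
have psum : \sum_j Cof (p j) = 1 by rewrite /Cof -rmorph_sum p_sum1.
move=> S S_psd.
rewrite /Mmat vecR vecC unf block_rank1_sum // => SS.
have Cof_ge0 (z : R) : (0 <= Cof z) = (0 <= z) by exact: ler0c.
(* The bound dominates a squared norm, hence is nonnegative; this makes the radicands nonnegative,
   so squaring undoes [Num.sqrt]. *)
have m_ge0 (S' : {set 'I_N}) (w : 'cV[R[i]]_(dimL d (parties S'))) :
    nrm2 w <= Cof (mfrak d kappa (parties S')) -> 0 <= mfrak d kappa (parties S').
  by move=> le_w; rewrite -Cof_ge0 (le_trans _ le_w) // nrm2_ge0.
have sq_ge0 q (w : 'cV[R]_q) : 0 <= sqnorm w by apply: sumr_ge0 => ? _; exact: sqr_ge0.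
have vec_le q1' q2' S' (w : 'cV[R]_q1') (c : 'cV[R]_q2')
    (z : 'cV[R[i]]_(dimL d (parties S'))) :
    nrm2 z <= Cof (mfrak d kappa (parties S')) ->
    nrm2 (col_mx (cmx w) (tensmx (cmx c) z : 'cV_(q2' * _))) <=
    Cof (Num.sqrt (sqnorm w + sqnorm c * mfrak d kappa (parties S'))) ^+ 2.
  move=> le_z; rewrite nrm2_col_mx nrm2_tens !nrm2_cmx.
  rewrite /Cof -rmorphXn /= sqr_sqrtr; last first.
    by rewrite addr_ge0 ?mulr_ge0 // (m_ge0 _ _ le_z).
  rewrite rmorphD rmorphM lerD2l; apply: ler_wpM2l => //.
  by rewrite ler0c.
have -> : Cof (Num.sqrt (sqnorm u + sqnorm alpha * mfrak d kappa (parties Rs)) *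
   Num.sqrt (sqnorm v + sqnorm beta * mfrak d kappa (parties (~: Rs)))) =
   Cof (Num.sqrt (sqnorm u + sqnorm alpha * mfrak d kappa (parties Rs))) *
   Cof (Num.sqrt (sqnorm v + sqnorm beta * mfrak d kappa (parties (~: Rs)))).
  by rewrite /Cof rmorphM.
apply: (trace_root_sum_le erefl _ psum _ _ _ _ S_psd SS) => [j|||j|j].
- by rewrite Cof_ge0.
- by rewrite Cof_ge0 sqrtr_ge0.
- by rewrite Cof_ge0 sqrtr_ge0.
- exact: vec_le.
- exact: vec_le.
Qed.
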